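(* Let $\mathbf{p}:(X,x)\to(\mathbf{X},\mathbf{x})=((X_\lambda,x_\lambda),p_{\lambda\lambda'},\Lambda)$ be an HPol$_*$-expansion of a pointed topological space $(X,x)$. Then for all $k\in\mathbb{N}$: (i) if the cardinality of $\Lambda$ is $\aleph_0$ and $\check{\pi}_k^{*^{top}}(X_\lambda,x_\lambda)$ is second countable for every $\lambda\in\Lambda$, then $\check{\pi}_k^{*^{top}}(X,x)$ is second countable; (ii) if $\check{\pi}_k^{*^{top}}(X_\lambda,x_\lambda)$ is totally disconnected for every $\lambda\in\Lambda$, then so is $\check{\pi}_k^{*^{top}}(X,x)$.
   Context: HTop$_*$ is the homotopy category of pointed topological spaces (pointed homotopy classes of pointed maps), HPol$_*$ its full subcategory of pointed spaces having the homotopy type of pointed polyhedra. Inverse systems are indexed by directed sets. Pro$^*$-category. For inverse systems $\mathbf{X}=(X_\lambda,p_{\lambda\lambda'},\Lambda)$, $\mathbf{Y}=(Y_\mu,q_{\mu\mu'},M)$ in a category $\mathcal{T}$, an $S^*$-morphism $(f,f^n_\mu):\mathbf{X}\to\mathbf{Y}$ consists of a function $f:M\to\Lambda$ and $\mathcal{T}$-morphisms $f^n_\mu:X_{f(\mu)}\to Y_\mu$ ($n\in\mathbb{N},\mu\in M$) such that for all $\mu\le\mu'$ there are $\lambda\ge f(\mu),f(\mu')$ and $n\in\mathbb{N}$ with $q_{\mu\mu'}f^{n'}_{\mu'}p_{f(\mu')\lambda}=f^{n'}_\mu p_{f(\mu)\lambda}$ for all $n'\ge n$. Two such, $(f,f^n_\mu)$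 and $(f',f'^n_\mu)$, are equivalent if for each $\mu\in M$ there are $\lambda\ge f(\mu),f'(\mu)$ and $n\in\mathbb{N}$ with $f^{n'}_\mu p_{f(\mu)\lambda}=f'^{n'}_\mu p_{f'(\mu)\lambda}$ for all $n'\ge n$. Composition: $(g,g^n_\nu)(f,f^n_\mu)=(fg,\,g^n_\nu f^n_{g(\nu)})$. Pro$^*$-$\mathcal{T}$ has inverse systems as objects and equivalence classes $[(f,f^n_\mu)]$ as morphisms; pro-$\mathcal{T}$ is regarded as a subcategory by $f^n_\mu=f_\mu$ for all $n$. Expansions. An HPol$_*$-expansion of $(X,x)$ is a morphism $\mathbf{p}=(p_\lambda):(X,x)\to(\mathbf{X},\mathbf{x})=((X_\lambda,x_\lambda),p_{\lambda\lambda'},\Lambda)$ in pro-HTop$_*$ with all $(X_\lambda,x_\lambda)$ in HPol$_*$ such that (E1) each morphism $h:(X,x)\to P$ of HTop$_*$ with $P$ in HPol$_*$ factors as $h=fp_\lambda$ for some $\lambda$ and $f:(X_\lambda,x_\lambda)\to P$; (E2) if $f_0,f_1:(X_\lambda,x_\lambda)\to P$, $P$ in HPol$_*$, satisfy $f_0p_\lambda=f_1p_\lambda$, then $f_0p_{\lambda\lambda'}=f_1p_{\lambda\lambda'}$ for some $\lambda'\ge\lambda$. Every pointed space has an HPol$_*$-expansion, unique up to a unique compatible isomorphism in pro-HPol$_*$. Pointed coarse shape category $Sh^*_*$. Objects: pointed spaces. A morphism $F^*:(X,x)\to(Y,y)$ is a class $\langle\mathbf{f}^*\rangle$ of pro$^*$-HPol$_*$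 morphisms between HPol$_*$-expansions of $(X,x)$ and $(Y,y)$, morphisms for different expansions being identified when they correspond under the canonical isomorphisms. Composition is by representatives; $Sh^*((X,x),(Y,y))$ is the set of such morphisms. Morphisms of HTop$_*$ (e.g. $p_\lambda$) induce coarse shape morphisms, written with the same symbol in compositions. $Sh^*((Y,y),(X,x))$ carries the topology with basis $V^{F^*}_\lambda=\{G^*:p_\lambda\circ F^*=p_\lambda\circ G^*\}$, for $F^*\in Sh^*((Y,y),(X,x))$, $\lambda\in\Lambda$, where $\mathbf{p}$ is any HPol$_*$-expansion of $(X,x)$; it is independent of $\mathbf{p}$. Coarse shape groups. For $k\in\mathbb{N}$, $\check\pi_k^*(X,x)=Sh^*((S^k,* ),(X,x))$, with group operation $F^*+G^*=\langle[(f^n_\lambda+g^n_\lambda)]\rangle$, where $F^*,G^*$ are represented by families $f^n_\lambda,g^n_\lambda:(S^k,* )\to(X_\lambda,x_\lambda)$ and $f^n_\lambda+g^n_\lambda$ is the operation of $\pi_k(X_\lambda,x_\lambda)$. $\check\pi_k^{*^{top}}(X,x)$ denotes this topological group with the topology on $Sh^*((S^k,* ),(X,x))$ whose basis consists of the sets $V^{F^*}_\lambda=\{G^*\in Sh^*((S^k,* ),(X,x)):p_\lambda\circ F^*=p_\lambda\circ G^*\}$, for $F^*\in Sh^*((S^k,* ),(X,x))$ and $\lambda\in\Lambda$. *)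

(* Defs.v *)
From HB Require Import structures.
From mathcomp Require Import all_boot all_order all_algebra generic_quotient.
From mathcomp Require Import all_classical all_reals topology normedtype.
From mathcomp Require Import finmap lra.

Set Implicit Arguments.
Unset Strict Implicit.
Unset Printing Implicit Defensive.

Import Order.TTheory GRing.Theory Num.Theory.
Import numFieldNormedType.Exports.

Local Open Scope classical_set_scope.
Local Open Scope ring_scope.
Local Open Scope quotient_scope.

Reserved Notation "g ∘ f" (at level 40, left associativity).

Section PropQuotient.
Context {T : Type} (e : T -> T -> Prop).
Hypothesis erefl_e : forall x, e x x.
Hypothesis esym_e : forall x y, e x y -> e y x.
Hypothesis etrans_e : forall x y z, e x y -> e y z -> e x z.

Let r : rel {classic T} := fun x y => `[< e x y >].

Let r_refl : reflexive r.
Proof. by move=> x; apply/asboolP. Qed.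

Let r_sym : symmetric r.
Proof. by move=> x y; apply/asboolP/asboolP; apply: esym_e. Qed.

Let r_trans : transitive r.
Proof. by move=> y x z /asboolP xy /asboolP yz; apply/asboolP/(etrans_e xy). Qed.

Definition prop_equiv : equiv_rel {classic T} := EquivRel r r_refl r_sym r_trans.

End PropQuotient.

Record category := Category {
  obj :> Type;
  hom : obj -> obj -> Type;
  idm : forall X, hom X X;
  catcomp : forall X Y Z, hom Y Z -> hom X Y -> hom X Z;
  compA : forall W X Y Z (h : hom Y Z) (g : hom X Y) (f : hom W X),
    catcomp h (catcomp g f) = catcomp (catcomp h g) f;
  comp1m : forall X Y (f : hom X Y), catcomp (idm Y) f = f;
  compm1 : forall X Y (f : hom X Y), catcomp f (idm X) = f }.

Arguments idm {c} X.
Arguments catcomp {c X Y Z} g f : simpl never.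
Notation "g ∘ f" := (catcomp g f).

Definition isomorphic (C : category) (X Y : C) :=
  exists (f : hom X Y) (g : hom Y X), g ∘ f = idm X /\ f ∘ g = idm Y.

(* Directed sets are nonempty and preordered, not necessarily antisymmetric. *)
Record directed_set := DirectedSet {
  dset :> Type;
  dle : dset -> dset -> Prop;
  dle_refl : forall a, dle a a;
  dle_trans : forall a b c, dle a b -> dle b c -> dle a c;
  dle_dir : forall a b, exists2 c, dle a c & dle b c;
  dset_inh : inhabited dset }.

Section ProStar.
Variable C : category.

Record inv_system := InvSystem {
  sys_index : directed_set;
  sys_obj :> sys_index -> C;
  bond : forall a b : sys_index, dle a b -> hom (sys_obj b) (sys_obj a);
  bond_id : forall a (h : dle a a), bond h = idm (sys_obj a);
  bond_comp : forall a b c (ab : dle a b) (bc : dle b c) (ac : dle a c),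
    bond ab ∘ bond bc = bond ac }.

Record smor (X Y : inv_system) := SMor {
  sidx : sys_index Y -> sys_index X;
  scomp : nat -> forall m : sys_index Y, hom (X (sidx m)) (Y m);
  scompP : forall m m' (mm' : dle m m'),
    exists l (h : dle (sidx m) l) (h' : dle (sidx m') l) n,
      forall n', (n <= n')%N ->
        bond mm' ∘ scomp n' m' ∘ bond h' = scomp n' m ∘ bond h }.

Definition smor_equiv X Y (f g : smor X Y) := forall m : sys_index Y,
  exists l (h : dle (sidx f m) l) (h' : dle (sidx g m) l) n,
    forall n', (n <= n')%N ->
      scomp f n' m ∘ bond h = scomp g n' m ∘ bond h'.

Lemma bond_irr X (a b : sys_index X) (h h' : dle a b) : bond h = bond h'.
Proof. by rewrite (Prop_irrelevance h h'). Qed.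

Lemma smor_equiv_refl X Y (f : smor X Y) : smor_equiv f f.
Proof.
by move=> m; exists (sidx f m), (dle_refl _), (dle_refl _), 0%N.
Qed.

Lemma smor_equiv_sym X Y (f g : smor X Y) : smor_equiv f g -> smor_equiv g f.
Proof.
move=> fg m; have [l [h [h' [n H]]]] := fg m.
by exists l, h', h, n => n' nn'; rewrite H.
Qed.

Lemma smor_equiv_trans X Y (f g k : smor X Y) :
  smor_equiv f g -> smor_equiv g k -> smor_equiv f k.
Proof.
move=> fg gk m.
have [l [h1 [h2 [n H]]]] := fg m; have [l' [h3 [h4 [n' H']]]] := gk m.
have [L lL l'L] := dle_dir l l'.
exists L, (dle_trans h1 lL), (dle_trans h4 l'L), (maxn n n') => i.
rewrite geq_max => /andP[ni n'i].
rewrite -(bond_comp h1 lL) -(bond_comp h4 l'L) !compA H // -H' //.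
rewrite -!compA (bond_comp h2 lL (dle_trans h2 lL)).
by rewrite (bond_comp h3 l'L (dle_trans h2 lL)).
Qed.

Definition smor_equiv_rel X Y : equiv_rel {classic smor X Y} :=
  prop_equiv (@smor_equiv_refl X Y) (@smor_equiv_sym X Y)
    (@smor_equiv_trans X Y).

Definition phom X Y := {eq_quot (smor_equiv_rel X Y)}.

Definition pcls X Y (f : smor X Y) : phom X Y := \pi_(phom X Y) f.
Definition prep X Y (f : phom X Y) : smor X Y := repr f.

Lemma prepK X Y (f : phom X Y) : pcls (prep f) = f.
Proof. exact: reprK. Qed.

Lemma pcls_eq X Y (f g : smor X Y) : pcls f = pcls g <-> smor_equiv f g.
Proof.
split; first by move/eqmodP => /= /asboolP.
by move=> fg; apply/eqmodP/asboolP.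
Qed.

Lemma prep_equiv X Y (f : smor X Y) : smor_equiv (prep (pcls f)) f.
Proof. by apply/pcls_eq; rewrite prepK. Qed.

Definition sid X : smor X X.
Proof.
refine (@SMor X X id (fun _ m => idm (X m)) _).
move=> m m' h; exists m', h, (dle_refl m'), 0%N => n' _.
by rewrite bond_id !compm1 comp1m.
Defined.

(* The sys_index function of the composite is fg, as f, g act contravariantly on
   indices. *)
Definition scompose X Y Z (g : smor Y Z) (f : smor X Y) : smor X Z.
Proof.
refine (@SMor X Z (fun m => sidx f (sidx g m))
  (fun n m => scomp g n m ∘ scomp f n (sidx g m)) _).
move=> m m' mm'; have [l [h [h' [n H]]]] := scompP g mm'.
have [a [k1 [k2 [i Hi]]]] := scompP f h.
have [b [k3 [k4 [j Hj]]]] := scompP f h'.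
have [c ac bc] := dle_dir a b.
exists c, (dle_trans k1 ac), (dle_trans k3 bc), (maxn n (maxn i j)) => N.
rewrite !geq_max => /and3P[nN iN jN].
rewrite -(bond_comp k1 ac) -(bond_comp k3 bc) !compA.
rewrite -(compA _ _ (bond k3)) -Hj // -(compA _ _ (bond k1)) -Hi //.
rewrite !compA H // -!compA; congr (_ ∘ (_ ∘ (_ ∘ _))).
by rewrite (bond_comp k4 bc (dle_trans k4 bc)) (bond_comp k2 ac (dle_trans k4 bc)).
Defined.

Lemma scompose_equiv X Y Z (g g' : smor Y Z) (f f' : smor X Y) :
  smor_equiv g g' -> smor_equiv f f' ->
  smor_equiv (scompose g f) (scompose g' f').
Proof.
move=> gg' ff'; apply: (@smor_equiv_trans _ _ _ (scompose g f')); move=> m /=.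
  have [l [h [h' [n H]]]] := ff' (sidx g m).
  by exists l, h, h', n => N nN; rewrite -!compA H.
have [l [h [h' [n H]]]] := gg' m.
have [a [k1 [k2 [i Hi]]]] := scompP f' h.
have [b [k3 [k4 [j Hj]]]] := scompP f' h'.
have [c ac bc] := dle_dir a b.
exists c, (dle_trans k1 ac), (dle_trans k3 bc), (maxn n (maxn i j)) => N.
rewrite !geq_max => /and3P[nN iN jN].
rewrite -(bond_comp k1 ac) -(bond_comp k3 bc) !compA.
rewrite -(compA _ _ (bond k3)) -Hj // -(compA _ _ (bond k1)) -Hi //.
rewrite !compA H // -!compA; congr (_ ∘ (_ ∘ (_ ∘ _))).
by rewrite (bond_comp k4 bc (dle_trans k4 bc)) (bond_comp k2 ac (dle_trans k4 bc)).
Qed.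

Definition pcomp X Y Z (g : phom Y Z) (f : phom X Y) : phom X Z :=
  pcls (scompose (prep g) (prep f)).

Lemma pcomp_cls X Y Z (g : smor Y Z) (f : smor X Y) :
  pcomp (pcls g) (pcls f) = pcls (scompose g f).
Proof. by apply/pcls_eq; apply: scompose_equiv; apply: prep_equiv. Qed.

Lemma pcompA W X Y Z (h : phom Y Z) (g : phom X Y) (f : phom W X) :
  pcomp h (pcomp g f) = pcomp (pcomp h g) f.
Proof.
rewrite -(prepK h) -(prepK g) -(prepK f) !pcomp_cls; apply/pcls_eq => m /=.
exists (sidx (prep f) (sidx (prep g) (sidx (prep h) m))).
by exists (dle_refl _), (dle_refl _), 0%N => n _; rewrite !compA.
Qed.

Lemma pcomp1m X Y (f : phom X Y) : pcomp (pcls (sid Y)) f = f.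
Proof.
rewrite -(prepK f) !pcomp_cls; apply/pcls_eq => m /=.
by exists (sidx (prep f) m), (dle_refl _), (dle_refl _), 0%N => n _; rewrite comp1m.
Qed.

Lemma pcompm1 X Y (f : phom X Y) : pcomp f (pcls (sid X)) = f.
Proof.
rewrite -(prepK f) !pcomp_cls; apply/pcls_eq => m /=.
by exists (sidx (prep f) m), (dle_refl _), (dle_refl _), 0%N => n _; rewrite compm1.
Qed.

Definition prostar : category := Category pcompA pcomp1m pcompm1.

End ProStar.

Arguments prostar C : clear implicits.

Section CoarseShape.
Variables (C : category) (P : C -> Prop).

(* An expansion with respect to the full subcategory of objects satisfying P.
   A morphism from an object to an inverse system in the pro-category is a
   family (p_l) commuting with the bonding morphisms. *)
Record expansion (X : C) := Expansion {
  xsys : inv_system C;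
  xsysP : forall l, P (xsys l);
  xproj : forall l, hom X (xsys l);
  xproj_bond : forall l l' (h : dle l l'), bond h ∘ xproj l' = xproj l;
  xE1 : forall Q (h : hom X Q), P Q ->
    exists l (f : hom (xsys l) Q), h = f ∘ xproj l;
  xE2 : forall Q l (f0 f1 : hom (xsys l) Q), P Q ->
    f0 ∘ xproj l = f1 ∘ xproj l ->
    exists l' (h : dle l l'), f0 ∘ bond h = f1 ∘ bond h }.

Arguments xsysP {X} e l.
Arguments xproj {X} e l.
Arguments xE1 {X} e {Q} h PQ : rename.
Arguments xE2 {X} e {Q l} f0 f1 PQ : rename.

(* The morphism u of the pro-category, regarded as a morphism of pro*-C with a
   constant sequence of components, satisfies u p = q h. *)
Definition is_lift X Y (p : expansion X) (q : expansion Y) (h : hom X Y)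
    (u : hom (xsys p : prostar C) (xsys q)) :=
  exists s : smor (xsys p) (xsys q), [/\ u = pcls s,
    forall n n' m, scomp s n m = scomp s n' m &
    forall n m, scomp s n m ∘ xproj p (sidx s m) = xproj q m ∘ h].

Arguments is_lift {X Y} p q h u.

Lemma lift_ex X Y (p : expansion X) (q : expansion Y) (h : hom X Y) :
  exists u, is_lift p q h u.
Proof.
have /choice[f Hf] : forall m, exists l : sys_index (xsys p),
    exists g : hom (xsys p l) (xsys q m), g ∘ xproj p l = xproj q m ∘ h.
  move=> m; have [l [g Hg]] := xE1 p (xproj q m ∘ h) (xsysP q m).
  by exists l, g.
pose g m := projT1 (cid (Hf m)).
have gP m : g m ∘ xproj p (f m) = xproj q m ∘ h := projT2 (cid (Hf m)).
have sP m m' (mm' : dle m m') : exists l (h : dle (f m) l) (h' : dle (f m') l) n,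
    forall n', (n <= n')%N -> bond mm' ∘ g m' ∘ bond h' = g m ∘ bond h.
  have [a h1 h2] := dle_dir (f m) (f m').
  have [||b [ab Hb]] := xE2 p (l := a) (bond mm' ∘ g m' ∘ bond h2) (g m ∘ bond h1).
  - exact: xsysP.
  - by rewrite -!compA !xproj_bond !gP compA xproj_bond.
  exists b, (dle_trans h1 ab), (dle_trans h2 ab), 0%N => _ _.
  by rewrite -(bond_comp h1 ab) -(bond_comp h2 ab) !compA Hb.
by exists (pcls (@SMor _ (xsys p) (xsys q) f (fun _ => g) sP)), (SMor sP).
Qed.

Lemma lift_uniq X Y (p : expansion X) (q : expansion Y) (h : hom X Y) u v :
  is_lift p q h u -> is_lift p q h v -> u = v.
Proof.
move=> [s [-> cs sh]] [t [-> ct th]]; apply/pcls_eq => m.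
have [a h1 h2] := dle_dir (sidx s m) (sidx t m).
have [||b [ab Hb]] :=
  xE2 p (l := a) (scomp s 0%N m ∘ bond h1) (scomp t 0%N m ∘ bond h2).
- exact: xsysP.
- by rewrite -!compA !xproj_bond sh th.
exists b, (dle_trans h1 ab), (dle_trans h2 ab), 0%N => n _.
by rewrite -(bond_comp h1 ab) -(bond_comp h2 ab) !compA (cs n 0%N) (ct n 0%N).
Qed.

Definition pro_lift X Y (p : expansion X) (q : expansion Y) (h : hom X Y) :
    hom (xsys p : prostar C) (xsys q) :=
  projT1 (cid (lift_ex p q h)).

Lemma liftP X Y (p : expansion X) (q : expansion Y) (h : hom X Y) :
  is_lift p q h (pro_lift p q h).
Proof. exact: (projT2 (cid (lift_ex p q h))). Qed.

Lemma lift_id X (p : expansion X) : pro_lift p p (idm X) = idm _.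
Proof.
apply: lift_uniq (liftP _ _ _) _; exists (sid (xsys p)); split => //= n m.
by rewrite comp1m compm1.
Qed.

Lemma lift_comp X Y Z (p : expansion X) (q : expansion Y) (r : expansion Z)
    (g : hom Y Z) (f : hom X Y) :
  pro_lift q r g ∘ pro_lift p q f = pro_lift p r (g ∘ f).
Proof.
apply: lift_uniq (liftP _ _ _).
have [s [-> cs sf]] := liftP p q f; have [t [-> ct tg]] := liftP q r g.
exists (scompose t s); split => /=.
- exact: pcomp_cls.
- by move=> n n' m; rewrite (ct n n') (cs n n').
- by move=> n m; rewrite -compA sf compA tg compA.
Qed.

(* The canonical isomorphism between two expansions of the same object. *)
Definition can_iso X (p p' : expansion X) := pro_lift p p' (idm X).

Lemma can_id X (p : expansion X) : can_iso p p = idm _.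
Proof. exact: lift_id. Qed.

Lemma can_comp X (p p' p'' : expansion X) : can_iso p' p'' ∘ can_iso p p' = can_iso p p''.
Proof. by rewrite /can_iso lift_comp comp1m. Qed.

Record sh_rep (X Y : C) := ShRep {
  sh_dom : expansion X;
  sh_cod : expansion Y;
  sh_mor : hom (xsys sh_dom : prostar C) (xsys sh_cod) }.

Definition sh_equiv X Y (F G : sh_rep X Y) :=
  sh_mor G ∘ can_iso (sh_dom F) (sh_dom G) = can_iso (sh_cod F) (sh_cod G) ∘ sh_mor F.

Lemma sh_equiv_refl X Y (F : sh_rep X Y) : sh_equiv F F.
Proof. by rewrite /sh_equiv !can_id compm1 comp1m. Qed.

Lemma sh_equiv_sym X Y (F G : sh_rep X Y) : sh_equiv F G -> sh_equiv G F.
Proof.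
rewrite /sh_equiv => FG.
rewrite -[sh_mor G]compm1 -(can_id (sh_dom G)) -(can_comp (sh_dom G) (sh_dom F) (sh_dom G)).
by rewrite (compA (sh_mor G)) FG !compA can_comp can_id comp1m.
Qed.

Lemma sh_equiv_trans X Y (F G H : sh_rep X Y) :
  sh_equiv F G -> sh_equiv G H -> sh_equiv F H.
Proof.
rewrite /sh_equiv => FG GH.
by rewrite -(can_comp _ (sh_dom G)) compA GH -compA FG compA can_comp.
Qed.

Definition sh_equiv_rel X Y : equiv_rel {classic sh_rep X Y} :=
  prop_equiv (@sh_equiv_refl X Y) (@sh_equiv_sym X Y) (@sh_equiv_trans X Y).

Definition coarse_shape X Y := {eq_quot (sh_equiv_rel X Y)}.

HB.instance Definition _ X Y :=
  Choice.copy (coarse_shape X Y) {eq_quot (sh_equiv_rel X Y)}.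

Definition sh_cls X Y (F : sh_rep X Y) : coarse_shape X Y :=
  \pi_(coarse_shape X Y) F.
Definition sh_repr X Y (F : coarse_shape X Y) : sh_rep X Y := repr F.

Lemma sh_reprK X Y (F : coarse_shape X Y) : sh_cls (sh_repr F) = F.
Proof. exact: reprK. Qed.

Lemma sh_cls_eq X Y (F G : sh_rep X Y) : sh_cls F = sh_cls G <-> sh_equiv F G.
Proof.
split; first by move/eqmodP => /= /asboolP.
by move=> fg; apply/eqmodP/asboolP.
Qed.

Definition sh_rep_comp X Y Z (G : sh_rep Y Z) (F : sh_rep X Y) : sh_rep X Z :=
  ShRep (sh_mor G ∘ can_iso (sh_cod F) (sh_dom G) ∘ sh_mor F).

Definition sh_comp X Y Z (G : coarse_shape Y Z) (F : coarse_shape X Y) :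
    coarse_shape X Z :=
  sh_cls (sh_rep_comp (sh_repr G) (sh_repr F)).

Lemma sh_comp_cls X Y Z (G : sh_rep Y Z) (F : sh_rep X Y) :
  sh_comp (sh_cls G) (sh_cls F) = sh_cls (sh_rep_comp G F).
Proof.
have := sh_reprK (sh_cls F); have := sh_reprK (sh_cls G).
rewrite /sh_comp; move: (sh_repr (sh_cls G)) (sh_repr (sh_cls F)) => G' F'.
move=> /sh_cls_eq GG /sh_cls_eq FF; apply/sh_cls_eq.
move: GG FF; rewrite /sh_equiv => GG FF.
change (sh_mor G ∘ can_iso (sh_cod F) (sh_dom G) ∘ sh_mor F ∘
    can_iso (sh_dom F') (sh_dom F) =
  can_iso (sh_cod G') (sh_cod G) ∘
    (sh_mor G' ∘ can_iso (sh_cod F') (sh_dom G') ∘ sh_mor F')).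
rewrite -compA FF !compA -GG -!compA; congr (_ ∘ _).
by rewrite !compA !can_comp.
Qed.

(* The coarse shape morphism induced by a morphism of C; by sh_of_indep it does
   not depend on the expansions used to express it. *)
Definition sh_of X Y (p : expansion X) (q : expansion Y) (h : hom X Y) :
    coarse_shape X Y :=
  sh_cls (ShRep (pro_lift p q h)).

Lemma sh_of_indep X Y (p p' : expansion X) (q q' : expansion Y) (h : hom X Y) :
  sh_of p q h = sh_of p' q' h.
Proof.
by apply/sh_cls_eq; rewrite /sh_equiv /= !lift_comp comp1m compm1.
Qed.

Definition unit_directed : directed_set.
Proof.
by refine (@DirectedSet unit (fun _ _ => True) _ _ _ (inhabits tt)) => //; exists tt.
Defined.

Definition rudimentary (X : C) : inv_system C.
Proof.
refine (@InvSystem C unit_directed (fun=> X) (fun _ _ _ => idm X) _ _) => //.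
by move=> *; rewrite comp1m.
Defined.

Definition id_expansion (X : C) (PX : P X) : expansion X.
Proof.
refine (@Expansion X (rudimentary X) (fun=> PX) (fun=> idm X) _ _ _) => /=.
- by move=> *; rewrite comp1m.
- by move=> Q h _; exists tt, h; rewrite compm1.
- by move=> Q [] f0 f1 _; rewrite !compm1 => ->; exists tt, I.
Defined.

(* p_l as a coarse shape morphism. *)
Definition sh_proj X (p : expansion X) (l : sys_index (xsys p)) :
    coarse_shape X (xsys p l) :=
  sh_of p (id_expansion (xsysP p l)) (xproj p l).

Arguments sh_proj {X} p l.

Definition sh_base X Y (p : expansion Y) (F : coarse_shape X Y)
    (l : sys_index (xsys p)) : set (coarse_shape X Y) :=
  [set G | sh_comp (sh_proj p l) F = sh_comp (sh_proj p l) G].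

Arguments sh_base {X Y} p F l.

Lemma sh_compA W X Y Z (H : coarse_shape Y Z) (G : coarse_shape X Y)
    (F : coarse_shape W X) :
  sh_comp H (sh_comp G F) = sh_comp (sh_comp H G) F.
Proof.
rewrite -(sh_reprK H) -(sh_reprK G) -(sh_reprK F) !sh_comp_cls.
by apply/sh_cls_eq; rewrite /sh_equiv /= !can_id compm1 comp1m !compA.
Qed.

Lemma sh_of_comp X Y Z (p : expansion X) (q q' : expansion Y) (r : expansion Z)
    (g : hom Y Z) (f : hom X Y) :
  sh_comp (sh_of q r g) (sh_of p q' f) = sh_of p r (g ∘ f).
Proof.
rewrite sh_comp_cls; apply/sh_cls_eq.
by rewrite /sh_equiv /= !can_id compm1 comp1m /can_iso !lift_comp compm1.
Qed.

Lemma sh_proj_factor Y (p q : expansion Y) (l : sys_index (xsys p)) :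
  exists (m : sys_index (xsys q)) K, sh_proj p l = sh_comp K (sh_proj q m).
Proof.
have [m [f Hf]] := xE1 q (xproj p l) (xsysP p l).
exists m, (sh_of (id_expansion (xsysP q m)) (id_expansion (xsysP p l)) f).
by rewrite sh_of_comp -Hf; exact: sh_of_indep.
Qed.

Lemma sh_proj_bond Y (p : expansion Y) (l l' : sys_index (xsys p)) (h : dle l l') :
  exists K, sh_proj p l = sh_comp K (sh_proj p l').
Proof.
exists (sh_of (id_expansion (xsysP p l')) (id_expansion (xsysP p l)) (bond h)).
by rewrite sh_of_comp xproj_bond.
Qed.

(* Each expansion p of Y gives, by sh_base_basis, a basis of the same topology;
   the definition uses all of them at once so as not to select one. *)
HB.instance Definition _ X Y := isSubBaseTopological.Build (coarse_shape X Y)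
  [set V | exists (p : expansion Y) F l, V = sh_base p F l] id.

Lemma sh_base_basis X Y (p : expansion Y) :
  basis [set V : set (coarse_shape X Y) | exists F l, V = sh_base p F l].
Proof.
have openV q F l : open (sh_base q F l : set (coarse_shape X Y)).
  exists [set sh_base q F l]; last by rewrite bigcup_set1.
  move=> _ ->; exists [fset (sh_base q F l : set (coarse_shape X Y))]%fset.
    by move=> V; rewrite in_fset1 => /eqP ->; apply/mem_set; exists q, F, l.
  by rewrite set_fset1 bigcap_set1.
split; first by move=> _ [F [l ->]]; exact: openV.
move=> F A; rewrite nbhsE => -[B [oB BF] BA].
suff [l lB] : exists l, sh_base p F l `<=` B.
  by exists (sh_base p F l); [split => //; exists F, l|exact: subset_trans BA].
case: oB => D' D'D eqB; move: BF; rewrite -eqB => -[V D'V VF].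
suff [l lV] : exists l, sh_base p F l `<=` V.
  by exists l => G /lV VG; exists V.
have [E ED EV] := D'D _ D'V; move: VF; rewrite -EV => {D' D'D eqB D'V EV B BA V A}.
suff H (s : seq (set (coarse_shape X Y))) :
  (forall V, V \in s -> V F /\ exists (q : expansion Y) G l, V = sh_base q G l) ->
    exists l, forall V, V \in s -> sh_base p F l `<=` V.
  move=> EF; have [V VE|l Hl] := H (enum_fset E).
    by split; [exact: EF|exact/set_mem/ED].
  by exists l => G lG V VE; exact: (Hl V VE G lG).
elim: s => [|V s IHs] Hs; first by have [l] := dset_inh (sys_index (xsys p)); exists l.
have [|l Hl] := IHs; first by move=> W Ws; apply: Hs; rewrite inE Ws orbT.
have [|VF [q [G [i VE]]]] := Hs V; first by rewrite inE eqxx.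
have [m [K HK]] := sh_proj_factor p i.
have [n ln mn] := dle_dir l m.
exists n => W; rewrite inE => /orP[/eqP ->|Ws] H nH; last first.
  apply: (Hl W Ws H); rewrite /sh_base /=.
  by have [L ->] := sh_proj_bond ln; rewrite -!sh_compA nH.
move: VF; rewrite VE /sh_base /= => ->.
have [L HL] := sh_proj_bond mn.
by rewrite HK HL -!sh_compA nH.
Qed.

End CoarseShape.

Arguments xsysP {C P X} e l.
Arguments xproj {C P X} e l.
Arguments xE1 {C P X} e {Q} h PQ : rename.
Arguments xE2 {C P X} e {Q l} f0 f1 PQ : rename.
Arguments is_lift {C P X Y} p q h u.
Arguments sh_proj {C P X} p l.
Arguments sh_base {C P X Y} p F l.

(* Small pointed spaces: their carriers lie in a universe below the one of the
   carriers of topologicalType, so that coarse_shape, whose elements range over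
   all expansions, is itself the carrier of a topologicalType. *)
Record pspace := PSpace {
  pspace_sort :> Type;
  pspace_class : Topological.axioms_ pspace_sort;
  pspace_point : pspace_sort }.

HB.instance Definition _ (X : pspace) :=
  Topological.copy (pspace_sort X) (Topological.Pack (pspace_class X)).
HB.instance Definition _ (X : pspace) :=
  isPointed.Build (pspace_sort X) (pspace_point X).

Section HTop.
Variable R : realType.

Record pmap (X Y : pspace) := PMap {
  pmap_fun :> X -> Y;
  pmap_continuous : continuous pmap_fun;
  pmap_point : pmap_fun point = point }.

Definition homotopic (X Y : pspace) (f g : pmap X Y) :=
  exists H : X * R -> Y,
    [/\ {within [set: X] `*` `[0, 1], continuous H},
      forall x, H (x, 0) = f x,
      forall x, H (x, 1) = g x &
      forall t : R, t \in `[0, 1] -> H (point, t) = point].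

Lemma within_comp (T U V : topologicalType) (A : set T) (B : set U)
    (phi : T -> U) (H : U -> V) :
  continuous phi -> (forall x, A x -> B (phi x)) ->
  {within B, continuous H} -> {within A, continuous (H \o phi)}.
Proof.
move=> cphi AB /subspace_continuousP cH; apply/subspace_continuousP => x Ax.
move=> W /(cH _ (AB _ Ax)); rewrite /nbhs /= /within /= => HW.
have := cphi x _ HW; rewrite /nbhs /= => {}HW.
by apply: filterS HW => y HW Ay; apply: HW; apply: AB.
Qed.

Lemma pair_continuous (T U V : topologicalType) (f : T -> U) (g : T -> V) :
  continuous f -> continuous g -> continuous (fun z => (f z, g z)).
Proof. by move=> cf cg z; apply: cvg_pair; [exact: cf|exact: cg]. Qed.

Lemma snd_continuous (T U : topologicalType) : continuous (@snd T U).
Proof. by move=> z; exact: cvg_snd. Qed.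

Lemma homotopic_refl X Y (f : pmap X Y) : homotopic f f.
Proof.
exists (f \o fst); split => //= [|t _]; last exact: pmap_point.
apply: continuous_subspaceT => z; apply: continuous_comp; first exact: cvg_fst.
exact: pmap_continuous.
Qed.

Lemma homotopic_sym X Y (f g : pmap X Y) : homotopic f g -> homotopic g f.
Proof.
move=> [H [cH H0 H1 Hp]].
exists (H \o (fun z => (z.1, 1 - z.2))); split => /= [|x|x|t].
- apply: within_comp cH.
    apply: pair_continuous => z; first exact: cvg_fst.
    by apply: cvgB; [exact: cvg_cst|exact: cvg_snd].
  by move=> [x t] [_] /=; rewrite !in_itv /= => /andP[? ?]; split => //=; lra.
- by rewrite subr0.
- by rewrite subrr.
- by rewrite in_itv /= => /andP[? ?]; apply: Hp; rewrite in_itv /=; lra.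
Qed.

Lemma homotopic_trans X Y (f g h : pmap X Y) :
  homotopic f g -> homotopic g h -> homotopic f h.
Proof.
move=> [H [cH H0 H1 Hp]] [K [cK K0 K1 Kp]].
pose L (z : X * R) := if z.2 <= 2^-1 then H (z.1, 2 * z.2)
                      else K (z.1, 2 * z.2 - 1).
have c2 (c : R) : continuous (fun z : X * R => (z.1, 2 * z.2 - c)).
  apply: pair_continuous => z; first exact: cvg_fst.
  apply: cvgB; last exact: cvg_cst.
  by apply: cvgM; [exact: cvg_cst|exact: cvg_snd].
have itv2 : [set: X] `*` `[0, 1] =
    ([set: X] `*` `[0, 2^-1]) `|` ([set: X] `*` `[2^-1, (1 : R)]).
  apply/seteqP; split => -[x t] /=; rewrite /setX /= !in_itv /=.
    by move=> [_ /andP[? ?]]; case: (leP t 2^-1) => ?; [left|right]; split => //; lra.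
  by move=> [] [_ /andP[? ?]]; split => //; lra.
have clX (a b : R) : closed ([set: X] `*` `[a, b]).
  have -> : [set: X] `*` `[a, b] = snd @^-1` `[a, b] :> set (X * R).
    by apply/seteqP; split => [z []|z] //=.
  move/continuous_closedP: (@snd_continuous X R); apply; exact: itv_closed.
exists L; split.
- rewrite itv2; apply: withinU_continuous => //.
    apply: (@subspace_eq_continuous _ _ _ (H \o (fun z => (z.1, 2 * z.2 - 0)))).
      move=> [x t] /set_mem[_] /=; rewrite in_itv /= => /andP[? t2].
      by rewrite /from_subspace /L /= t2 subr0.
    apply: within_comp cH => //.
    by move=> [x t] [_] /=; rewrite !in_itv /= => /andP[? ?]; split => //=; lra.
  apply: (@subspace_eq_continuous _ _ _ (K \o (fun z => (z.1, 2 * z.2 - 1)))).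
    move=> [x t] /set_mem[_] /=; rewrite in_itv /= => /andP[t2 ?].
    rewrite /from_subspace /L /=; case: leP => // t2'.
    have -> : t = 2^-1 by apply/eqP; rewrite eq_le t2 t2'.
    by rewrite divff ?pnatr_eq0 // subrr H1 K0.
  apply: within_comp cK => //.
  by move=> [x t] [_] /=; rewrite !in_itv /= => /andP[? ?]; split => //=; lra.
- by move=> x; rewrite /L /= mulr0 ifT //; lra.
- by move=> x; rewrite /L /= ifF ?mulr1; [rewrite -K1; congr (K (_, _)); lra|apply/negbTE; lra].
- move=> t; rewrite in_itv /= => /andP[? ?]; rewrite /L /=; case: ifPn => ?.
    by apply: Hp; rewrite in_itv /=; lra.
  by apply: Kp; rewrite in_itv /=; lra.
Qed.

Definition homotopic_rel X Y : equiv_rel {classic pmap X Y} :=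
  prop_equiv (@homotopic_refl X Y) (@homotopic_sym X Y) (@homotopic_trans X Y).

Definition htop_hom X Y := {eq_quot (homotopic_rel X Y)}.

Definition hcls X Y (f : pmap X Y) : htop_hom X Y := \pi_(htop_hom X Y) f.
Definition hrep X Y (f : htop_hom X Y) : pmap X Y := repr f.

Lemma hrepK X Y (f : htop_hom X Y) : hcls (hrep f) = f.
Proof. exact: reprK. Qed.

Lemma hcls_eq X Y (f g : pmap X Y) : hcls f = hcls g <-> homotopic f g.
Proof.
split; first by move/eqmodP => /= /asboolP.
by move=> fg; apply/eqmodP/asboolP.
Qed.

Lemma hrep_homotopic X Y (f : pmap X Y) : homotopic (hrep (hcls f)) f.
Proof. by apply/hcls_eq; rewrite hrepK. Qed.

Definition pmap_id X : pmap X X.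
Proof. by refine (@PMap X X id _ erefl) => x; exact: cvg_id. Defined.

Definition pmap_comp X Y Z (g : pmap Y Z) (f : pmap X Y) : pmap X Z.
Proof.
refine (@PMap X Z (g \o f) _ _).
  by move=> x; apply: continuous_comp; exact: pmap_continuous.
by rewrite /= !pmap_point.
Defined.

Lemma pmap_ext X Y (f g : pmap X Y) : f =1 g -> f = g.
Proof.
case: f g => f cf f0 [g cg g0] /= /funext fg; subst g.
by rewrite (Prop_irrelevance cf cg) (Prop_irrelevance f0 g0).
Qed.

Lemma pmap_comp_homotopic X Y Z (g g' : pmap Y Z) (f f' : pmap X Y) :
  homotopic g g' -> homotopic f f' ->
  homotopic (pmap_comp g f) (pmap_comp g' f').
Proof.
move=> [K [cK K0 K1 Kp]] [H [cH H0 H1 Hp]].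
apply: (@homotopic_trans _ _ _ (pmap_comp g f')).
  exists (g \o H); split => /= [|x|x|t t01]; last by rewrite Hp ?pmap_point.
  - move=> z; apply: (continuous_comp (cH z)); exact: pmap_continuous.
  - by rewrite H0.
  - by rewrite H1.
exists (K \o (fun z => (f' z.1, z.2))); split => /= [|x|x|t t01].
- apply: within_comp cK; last by move=> [].
  apply: pair_continuous => z; last exact: cvg_snd.
  by apply: (@continuous_comp _ _ _ fst f'); [exact: cvg_fst|exact: pmap_continuous].
- by rewrite K0.
- by rewrite K1.
- by rewrite pmap_point Kp.
Qed.

Definition htop_comp X Y Z (g : htop_hom Y Z) (f : htop_hom X Y) :
    htop_hom X Z :=
  hcls (pmap_comp (hrep g) (hrep f)).

Lemma htop_comp_cls X Y Z (g : pmap Y Z) (f : pmap X Y) :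
  htop_comp (hcls g) (hcls f) = hcls (pmap_comp g f).
Proof.
by apply/hcls_eq; apply: pmap_comp_homotopic; exact: hrep_homotopic.
Qed.

Lemma htop_compA W X Y Z (h : htop_hom Y Z) (g : htop_hom X Y)
    (f : htop_hom W X) :
  htop_comp h (htop_comp g f) = htop_comp (htop_comp h g) f.
Proof.
rewrite -(hrepK h) -(hrepK g) -(hrepK f) !htop_comp_cls.
by congr hcls; exact: pmap_ext.
Qed.

Lemma htop_comp1m X Y (f : htop_hom X Y) : htop_comp (hcls (pmap_id Y)) f = f.
Proof. by rewrite -(hrepK f) htop_comp_cls; congr hcls; exact: pmap_ext. Qed.

Lemma htop_compm1 X Y (f : htop_hom X Y) : htop_comp f (hcls (pmap_id X)) = f.
Proof. by rewrite -(hrepK f) htop_comp_cls; congr hcls; exact: pmap_ext. Qed.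

Definition htop : category := Category htop_compA htop_comp1m htop_compm1.

Record simplicial_complex := SimplicialComplex {
  vertex : Type;
  simplex : set (set vertex);
  simplex_finite : forall s, simplex s -> finite_set s;
  simplex_neq0 : forall s, simplex s -> s !=set0;
  simplex_face : forall s t, simplex s -> t `<=` s -> t !=set0 -> simplex t;
  simplex_vertex : forall v, simplex [set v] }.

(* The points of the polyhedron |K|, in barycentric coordinates; the sum is that
   of the finitely many nonzero coordinates. *)
Record polyhedron (K : simplicial_complex) := Polyhedron {
  bary : vertex K -> R;
  bary_ge0 : forall v, 0 <= bary v;
  bary_supp : simplex [set v | bary v != 0];
  bary_sum : \sum_(v \in [set: {classic vertex K}]) bary v = 1 }.

HB.instance Definition _ K := gen_eqMixin (polyhedron K).
HB.instance Definition _ K := gen_choiceMixin (polyhedron K).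

(* The weak (CW) topology of |K|: a set is open when its trace on each closed
   simplex is open in the Euclidean topology, which is the topology of pointwise
   convergence of the (finitely many nonzero) barycentric coordinates. *)
Definition polyhedron_open K : set (set (polyhedron K)) :=
  [set U | forall s, simplex s ->
    exists2 W : set (prod_topology (fun _ : vertex K => (R : topologicalType))),
      open W & forall a : polyhedron K, [set v | bary a v != 0] `<=` s ->
        U a <-> W (bary a)].

Lemma polyhedron_openT K : polyhedron_open [set: polyhedron K].
Proof. by move=> s _; exists setT; [exact: openT|]. Qed.

Lemma polyhedron_openI K : setI_closed (@polyhedron_open K).
Proof.
move=> U V oU oV s Ks; have [A oA UA] := oU s Ks; have [B oB VB] := oV s Ks.
by exists (A `&` B); [exact: openI|move=> a sa; split => -[/UA ? /VB ?]; split; auto].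
Qed.

Lemma polyhedron_open_bigU K (I : Type) (F : I -> set (polyhedron K)) :
  (forall i, polyhedron_open (F i)) -> polyhedron_open (\bigcup_i F i).
Proof.
move=> oF s Ks; have /choice[A HA] : forall i,
    exists A : set (prod_topology (fun _ : vertex K => (R : topologicalType))),
      open A /\ forall a : polyhedron K, [set v | bary a v != 0] `<=` s ->
        F i a <-> A (bary a).
  by move=> i; have [A oA FA] := oF i s Ks; exists A.
exists (\bigcup_i A i); first by apply: bigcup_open => i _; have [] := HA i.
move=> a sa; split => -[i _ Hi]; exists i => //; have [_ H] := HA i;
  by apply/(H a sa).
Qed.

HB.instance Definition _ K := isOpenTopological.Build (polyhedron K)
  (@polyhedron_openT K) (@polyhedron_openI K) (@polyhedron_open_bigU K).

(* S^k, topologized as a subspace of R^(k+1), with base point (1, 0, .., 0). Its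
   points are stored as lists of coordinates because the type of row vectors is
   not small in the sense of pspace. *)
Record sphere_pt (k : nat) := SpherePt {
  sphere_coord : seq R;
  sphere_size : size sphere_coord = k.+1;
  sphere_norm : \sum_(c <- sphere_coord) c ^+ 2 = 1 }.

Definition sphere_vec k (x : sphere_pt k) : 'rV[R]_k.+1 :=
  \row_i (sphere_coord x)`_i.

HB.instance Definition _ k := gen_eqMixin (sphere_pt k).
HB.instance Definition _ k := gen_choiceMixin (sphere_pt k).
HB.instance Definition _ k :=
  Topological.copy (sphere_pt k) (initial_topology (@sphere_vec k)).

Definition sphere_base k : sphere_pt k.
Proof.
refine (@SpherePt k (1 :: nseq k 0) _ _); first by rewrite /= size_nseq.
rewrite big_cons big1_seq ?addr0 ?expr1n // => c /andP[_].
by rewrite mem_nseq => /andP[_ /eqP ->]; rewrite expr0n.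
Defined.

Definition psphere (k : nat) : pspace :=
  PSpace (Topological.on (sphere_pt k)) (sphere_base k).

Definition hpol (X : htop) :=
  exists K (a : polyhedron K),
    isomorphic X (PSpace (Topological.on (polyhedron K)) a : htop).

(* The group operation plays no role for second countability and total
   disconnectedness, and is left out. *)
Definition top_coarse_shape_group (k : nat) (X : pspace) : topologicalType :=
  coarse_shape hpol (psphere k : htop) (X : htop).

End HTop.

Arguments hpol {R} X.

(* Main.v *)
(** Equality of coarse shape morphisms into Y is tested at each index l of an
    expansion of Y separately, so the maps F |-> p_l F are jointly injective and
    the clopen basic sets separate points: the space is zero-dimensional.  A
    space X_l of the expansion is its own expansion, so the morphisms into it form
    a discrete space, which is second countable only if it is countable; the
    basic open sets, being the fibres of the maps F |-> p_l F, are then countably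
    many as soon as the indices l are. *)

Require Import Defs.
From HB Require Import structures.
From mathcomp Require Import all_boot all_order all_algebra.
From mathcomp Require Import all_classical all_reals topology.

Set Implicit Arguments.
Unset Strict Implicit.
Unset Printing Implicit Defensive.

Local Open Scope classical_set_scope.
Local Open Scope card_scope.

Section CoarseShapeTopology.
Context {C : category} {P : C -> Prop}.

(** The lift of an identity is a canonical isomorphism, and changing expansions along it leaves a
    coarse shape morphism the same. *)
Lemma sh_of_id_comp {X Y : C} (q q' : expansion P Y) (F : coarse_shape P X Y) :
  sh_comp (sh_of q q' (idm Y)) F = F.
Proof.
rewrite -(sh_reprK F) sh_comp_cls; apply/sh_cls_eq.
rewrite /sh_equiv /= can_id compm1 !Defs.compA /can_iso !lift_comp !comp1m.
by rewrite lift_id comp1m.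
Qed.

(** Composing a representative on both sides with canonical isomorphisms moves it to prescribed
    expansions. *)
Lemma sh_cls_surj {X Y : C} (q : expansion P X) (p : expansion P Y)
    (F : coarse_shape P X Y) :
  exists u : Defs.hom (xsys q : prostar C) (xsys p), F = sh_cls (ShRep u).
Proof.
exists (can_iso (sh_cod (sh_repr F)) p ∘ sh_mor (sh_repr F)
  ∘ can_iso q (sh_dom (sh_repr F))).
rewrite -[LHS]sh_reprK; apply/sh_cls_eq.
by rewrite /sh_equiv /= -Defs.compA Defs.can_comp can_id compm1.
Qed.

(* The constant lift of p_l is represented by the single component id : X_l -> X_l,
   so composing with it picks out the l-th components. *)
Lemma pro_lift_proj {X : C} (p : expansion P X) (l : sys_index (xsys p)) :
  exists s : smor (xsys p) (rudimentary (xsys p l)),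
    pro_lift p (id_expansion (xsysP p l)) (xproj p l) = pcls s /\
    forall Z (u v : smor Z (xsys p)),
      smor_equiv (scompose s u) (scompose s v) ->
      exists a (h : dle (sidx u l) a) (h' : dle (sidx v l) a) n,
        forall n', (n <= n')%N ->
          scomp u n' l ∘ bond h = scomp v n' l ∘ bond h'.
Proof.
have sP (m m' : unit_directed) (mm' : dle m m') :
    exists a (h : dle l a) (h' : dle l a) n, forall n', (n <= n')%N ->
      bond (i := rudimentary (xsys p l)) mm' ∘ idm (xsys p l) ∘ bond h' =
      idm (xsys p l) ∘ bond h.
  exists l, (dle_refl l), (dle_refl l), 0%N => n' _.
  by rewrite /= !comp1m.
exists (@SMor _ (xsys p) (rudimentary (xsys p l)) (fun=> l)
  (fun _ _ => idm (xsys p l)) sP); split.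
  apply: lift_uniq (liftP _ _ _) _; eexists; split; first by [].
    by [].
  by move=> n m /=.
move=> Z u v /(_ tt) /= [a [h [h' [n H]]]].
by exists a, h, h', n => n' /H; rewrite !comp1m.
Qed.

Lemma prostar_comp_cls {X Y Z : inv_system C} (g : smor Y Z) (f : smor X Y) :
  (pcls g : Defs.hom (Y : prostar C) Z) ∘ pcls f = pcls (scompose g f).
Proof. exact: pcomp_cls. Qed.

Lemma sh_proj_inj {X Y : C} (p : expansion P Y) (F G : coarse_shape P X Y) :
  (forall l, sh_comp (sh_proj p l) F = sh_comp (sh_proj p l) G) -> F = G.
Proof.
(* [X] comes with no chosen expansion; a representative of [F] supplies one. *)
move: (sh_dom (sh_repr F)) => q FG.
have [u Fu] := sh_cls_surj q p F; have [v Gv] := sh_cls_surj q p G.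
subst F G; rewrite -(prepK u) -(prepK v) in FG *.
move: (prep u) (prep v) FG => {}u {}v FG; apply/sh_cls_eq.
rewrite /sh_equiv /= !can_id compm1 comp1m; apply/pcls_eq => l.
have [s [sE]] := pro_lift_proj l; apply.
have := FG l; rewrite !sh_comp_cls => /sh_cls_eq.
rewrite /sh_equiv /= !can_id !compm1 comp1m sE.
by rewrite !prostar_comp_cls => /pcls_eq.
Qed.

Lemma sh_base_refl {X Y : C} (p : expansion P Y) (F : coarse_shape P X Y) l :
  sh_base p F l F.
Proof. by []. Qed.

Lemma sh_base_open {X Y : C} (p : expansion P Y) (F : coarse_shape P X Y) l :
  open (sh_base p F l).
Proof. by have [+ _] := @sh_base_basis C P X Y p; apply; exists F, l. Qed.

(** For fixed [l] these sets are the classes of an equivalence relation, so the complement of one is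
    a union of others. *)
Lemma sh_base_clopen {X Y : C} (p : expansion P Y) (F : coarse_shape P X Y) l :
  clopen (sh_base p F l).
Proof.
split; first exact: sh_base_open.
rewrite -openC openE => G nFG.
apply: (@filterS _ _ _ (sh_base p G l)).
  by move=> H; rewrite /sh_base /= => GH FH; apply: nFG; rewrite /sh_base /= GH.
by apply: open_nbhs_nbhs; split; [exact: sh_base_open|exact: sh_base_refl].
Qed.

Lemma coarse_shape_zero_dimensional {X Y : C} (p : expansion P Y) :
  zero_dimensional (coarse_shape P X Y).
Proof.
move=> F G FG.
have [l Hl] : exists l, ~ sh_base p F l G.
  apply/existsNP => FGp; move/eqP: FG; apply.
  by apply: sh_proj_inj => l; exact: FGp.
by exists (sh_base p F l); split; [exact: sh_base_clopen|exact: sh_base_refl|].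
Qed.

(** The sole projection of [id_expansion PQ] is induced by an identity, so its basic sets are
    singletons. *)
Lemma coarse_shape_open1 {X Q : C} (PQ : P Q) (F : coarse_shape P X Q) :
  open [set F].
Proof.
suff -> : [set F] = sh_base (id_expansion PQ) F tt by exact: sh_base_open.
apply/seteqP; split => [_ ->|G]; first exact: sh_base_refl.
by rewrite /sh_base /= /sh_proj /= !sh_of_id_comp => ->.
Qed.

End CoarseShapeTopology.

(** Every basis of a discrete space contains all singletons, so [x |-> [set x]] injects the space
    into a countable basis. *)
Lemma countable_of_second_countable_discrete (T : topologicalType) :
  (forall x : T, open [set x]) -> @second_countable T -> countable [set: T].
Proof.
move=> op1 [B /countable_injP[g ginj] [_ Bb]].
have B1 x : B [set x].
  have [|U [BU Ux] Ux1] := Bb x [set x].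
    by apply: open_nbhs_nbhs; split.
  suff <- : U = [set x] by [].
  by apply/seteqP; split => // _ ->.
apply/countable_injP; exists (fun x => g [set x]) => x y _ _ gxy.
have /seteqP[+ _] := ginj _ _ (mem_set (B1 x)) (mem_set (B1 y)) gxy.
exact.
Qed.

Lemma coarse_shape_second_countable {C : category} {P : C -> Prop} {X Y : C}
    (p : expansion P Y) :
  countable [set: sys_index (xsys p)] ->
  (forall l, @second_countable (coarse_shape P X (xsys p l))) ->
  @second_countable (coarse_shape P X Y).
Proof.
move=> cI cX; exists [set V | exists F l, V = sh_base p F l]; last first.
  exact: sh_base_basis.
(* The fibres over all morphisms into the [l]-th space, possibly empty ones included, form a
   countable family containing the basis. *)
apply: (@sub_countable _ _ _ (\bigcup_l
    (fun G => sh_comp (sh_proj p l) @^-1` [set G]) @` setT)); last first.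
  apply: bigcup_countable => // l _.
  apply: (sub_countable (card_image_le _ _)).
  apply: countable_of_second_countable_discrete (cX l) => F.
  exact: (coarse_shape_open1 (xsysP p l)).
apply: subset_card_le => _ [F [l ->]].
exists l => //; exists (sh_comp (sh_proj p l) F) => //.
by apply/seteqP; split => G; rewrite /sh_base /=.
Qed.

Theorem corollary4p7 (R : realType) (X : pspace)
    (p : expansion hpol (X : htop R)) (k : nat) (k_gt0 : (0 < k)%N) :
  ([set: sys_index (xsys p)] #= [set: nat] ->
    (forall l : sys_index (xsys p),
      @second_countable (top_coarse_shape_group R k (xsys p l))) ->
    @second_countable (top_coarse_shape_group R k X)) /\
  ((forall l : sys_index (xsys p),
      totally_disconnected [set: top_coarse_shape_group R k (xsys p l)]) ->
    totally_disconnected [set: top_coarse_shape_group R k X]).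
Proof.
split=> [eN cX|_]; last first.
  exact/zero_dimension_totally_disconnected/(coarse_shape_zero_dimensional p).
apply: (coarse_shape_second_countable (p := p)) => //.
by rewrite (eq_countable eN); exact: countableP.
Qed.
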